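(* For the approximation problem $\mathrm{APP}=\{\mathrm{APP}_s\}_{s\in\mathbb N}$ the following are equivalent: $\mathrm{APP}$ is WT; $\mathrm{APP}$ is UWT; $m_0=1$.
   Context: Notation: $\mathbb N=\{1,2,\dots\}$, $\mathbb N_0=\{0,1,2,\dots\}$. Setting. $H$ is an infinite-dimensional separable Hilbert space over $\mathbb R$ or $\mathbb C$ with orthonormal basis $\{e_k\}_{k\in\mathbb N_0}$; $\omega\in(0,1)$; $\boldsymbol m=\{m_k\}_{k\in\mathbb N_0}$ is a bounded sequence of positive integers; $r_0=0$ and $r_k=m_0+\cdots+m_{k-1}$ for $k\ge1$. For $n\in\mathbb N_0$ let $k(n)$ be the unique $k\in\mathbb N_0$ with $r_k\le n\le r_{k+1}-1$. For $a,b>0$ let $$H_{a,b}=\Big\{f\in H:\ \|f\|_{H_{a,b}}:=\Big(\sum_{k=0}^\infty\omega^{-ak^b}\sum_{j=r_k}^{r_{k+1}-1}|\langle f,e_j\rangle_H|^2\Big)^{1/2}<\infty\Big\}.$$ The sequences $\boldsymbol a=\{a_j\}_{j\in\mathbb N}$, $\boldsymbol b=\{b_j\}_{j\in\mathbb N}$ consist of positive reals with $0<a_1\le a_2\le\cdots$ and $\inf_jb_j>0$. Let $H_s=H\otimes\cdots\otimes H$ ($s$-fold Hilbert tensor product) with orthonormal basis $e_{\boldsymbol n}=e_{n_1}\otimes\cdots\otimes e_{n_s}$, $\boldsymbol n\in\mathbb N_0^s$, and $H_{s,\boldsymbol a,\boldsymbol b}=H_{a_1,b_1}\otimes\cdots\otimes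 H_{a_s,b_s}$; equivalently, $H_{s,\boldsymbol a,\boldsymbol b}$ is the set of $f\in H_s$ with $\|f\|_{H_{s,\boldsymbol a,\boldsymbol b}}^2=\sum_{\boldsymbol n\in\mathbb N_0^s}\omega^{-\sum_{j=1}^sa_j[k(n_j)]^{b_j}}|\langle f,e_{\boldsymbol n}\rangle_{H_s}|^2<\infty$. The operator $\mathrm{APP}_s:H_{s,\boldsymbol a,\boldsymbol b}\to H_s$ is the embedding $\mathrm{APP}_sf=f$. Information complexity. For $n\in\mathbb N_0$, $e(n,\mathrm{APP}_s)=\inf_{A_n}\sup_{\|f\|_{H_{s,\boldsymbol a,\boldsymbol b}}\le1}\|f-A_nf\|_{H_s}$, the infimum being over all algorithms $A_nf=\sum_{j=1}^nL_j(f)g_j$ with continuous linear functionals $L_j$ on $H_{s,\boldsymbol a,\boldsymbol b}$ and $g_j\in H_s$ ($A_0=0$). For $\varepsilon>0$, $n(\varepsilon,\mathrm{APP}_s)=\min\{n\in\mathbb N_0:\ e(n,\mathrm{APP}_s)\le\varepsilon\}$. For $t_1,t_2>0$, $(t_1,t_2)$-WT means $$\lim_{s+\varepsilon^{-1}\to\infty}\frac{\log n(\varepsilon,\mathrm{APP}_s)}{s^{t_1}+\varepsilon^{-t_2}}=0,$$ the limit being over $s\in\mathbb N$, $\varepsilon\in(0,1)$. WT (weak tractability) means $(1,1)$-WT. UWT (uniform weak tractability) means that $(t_1,t_2)$-WT holds for all $t_1,t_2\in(0,1]$. *)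

(* Defs.v *)
From HB Require Import structures.
From mathcomp Require Import all_boot all_order all_algebra.
From mathcomp Require Import complex.
From mathcomp Require Import all_classical all_reals all_analysis.

Set Implicit Arguments.
Unset Strict Implicit.
Unset Printing Implicit Defensive.
Import Order.TTheory GRing.Theory Num.Theory.
Import numFieldNormedType.Exports.
Local Open Scope classical_set_scope.
Local Open Scope ring_scope.

Inductive scalarKind := RealScalars | ComplexScalars.

Definition scalarField (R : realType) (F : scalarKind) : numFieldType :=
  match F with RealScalars => R | ComplexScalars => R[i] end.

Definition sconj (R : realType) (F : scalarKind) : scalarField R F -> scalarField R F :=
  match F with RealScalars => idfun | ComplexScalars => @conjc R end.

(* Norms over [R[i]] are [R[i]]-valued (with zero imaginary part) in the
   library; [sreal] brings them back to [R]. *)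
Definition sreal (R : realType) (F : scalarKind) : scalarField R F -> R :=
  match F with RealScalars => idfun | ComplexScalars => @complex.Re R end.

Definition sabs (R : realType) (F : scalarKind) (z : scalarField R F) : R :=
  sreal `|z|.

(* [hdot] is linear in its first argument and conjugate-linear in its second. *)
Record hilbertSpace (R : realType) (F : scalarKind) := HilbertSpace {
  hcarrier :> completeNormedModType (scalarField R F);
  hdot : {dot hcarrier for @sconj R F};
  hdotE : forall x : hcarrier, `|x| ^+ 2 = hdot x x
}.

Definition hnorm (R : realType) (F : scalarKind) (H : hilbertSpace R F)
  (x : H) : R := sreal `|x|.

Definition orthonormal_basis (R : realType) (F : scalarKind)
    (H : hilbertSpace R F) (e : nat -> H) : Prop :=
  (forall i j, hdot H (e i) (e j) = (i == j)%:R) /\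
  (forall f : H, (fun n => \sum_(k < n) hdot H f (e k) *: e k) @ \oo --> f).

(* An s-fold Hilbert tensor power of H, determined up to a unitary
   isomorphism compatible with [tens]: a Hilbert space with a multilinear map
   [tens : (f_1, ..., f_s) |-> f_1 (x) ... (x) f_s] satisfying the product
   formula for inner products, whose range spans a dense subspace. *)
Record tensorPower (R : realType) (F : scalarKind) (H : hilbertSpace R F)
    (s : nat) := TensorPower {
  tspace :> hilbertSpace R F;
  tens : ('I_s -> H) -> tspace;
  tens_multilinear : forall (u : 'I_s -> H) (i : 'I_s) (c : scalarField R F)
    (x y : H), tens (dfwith u i (c *: x + y)) =
      c *: tens (dfwith u i x) + tens (dfwith u i y);
  tens_dot : forall u v : 'I_s -> H,
    hdot tspace (tens u) (tens v) = \prod_(i < s) hdot H (u i) (v i);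
  tens_dense : dense [set f : tspace |
    exists (n : nat) (c : 'I_n -> scalarField R F) (u : 'I_n -> 'I_s -> H),
      f = \sum_(i < n) c i *: tens (u i)]
}.

Definition rblock (m : nat -> nat) (k : nat) : nat := (\sum_(i < k) m i)%N.

(* k(n); for positive m_k there is exactly one such k. *)
Definition blockidx (m : nat -> nat) (n : nat) : nat :=
  xget 0%N [set k : nat | (rblock m k <= n <= (rblock m k.+1).-1)%N].

(* Sequences indexed by {1, 2, ...} are functions on [nat] shifted by one:
   [a j] is a_{j+1}, [b j] is b_{j+1}. *)
Section Approximation.
Variables (R : realType) (F : scalarKind) (H : hilbertSpace R F) (e : nat -> H).
Variables (omega : R) (m : nat -> nat) (a b : nat -> R).

Section FixedDimension.
Variables (s : nat) (T : tensorPower H s).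

Definition tbasis (n : {ffun 'I_s -> nat}) : T := tens T (fun j => e (n j)).

(* The norm of H_{s,a,b}, extended by +oo outside of H_{s,a,b}. *)
Definition wnorm (f : T) : \bar R :=
  sqrte (\esum_(n in [set: {ffun 'I_s -> nat}])
    (omega `^ (- \sum_(j < s) a j * (blockidx m (n j))%:R `^ b j)
     * sabs (hdot T f (tbasis n)) ^+ 2)%:E).

Definition wspace : set T := [set f | (wnorm f < +oo)%E].

(* Only the restriction of [L] to H_{s,a,b} matters. *)
Definition continuous_functional (L : T -> scalarField R F) : Prop :=
  (forall (c : scalarField R F) (f g : T), wspace f -> wspace g ->
     L (c *: f + g) = c * L f + L g) /\
  (forall f : T, wspace f -> forall d : R, 0 < d ->
     exists2 r : R, 0 < r & forall g : T, wspace g ->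
       (wnorm (g - f)%R < r%:E)%E -> sabs (L g - L f) < d).

Definition worst_error (A : T -> T) : \bar R :=
  ereal_sup [set (hnorm (f - A f))%:E | f in [set f | (wnorm f <= 1)%E]].

Definition algorithm (n : nat) (A : T -> T) : Prop :=
  exists (L : 'I_n -> T -> scalarField R F) (g : 'I_n -> T),
    (forall j, continuous_functional (L j)) /\
    A = (fun f => \sum_(j < n) L j f *: g j).

Definition min_error (n : nat) : \bar R :=
  ereal_inf [set worst_error A | A in algorithm n].

(* The minimum of a set of natural numbers, with value +oo on the empty set. *)
Definition info_complexity (eps : R) : \bar R :=
  ereal_inf [set n%:R%:E | n in [set n | (min_error n <= eps%:E)%E]].

End FixedDimension.

Variable T : forall s, tensorPower H s.

(* s + 1/eps tends to +oo, over s >= 1 and 0 < eps < 1. *)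
Definition large_s_inveps : set_system (nat * R) :=
  filter_from setT (fun B : R => [set p : nat * R |
    [/\ (0 < p.1)%N, 0 < p.2 < 1 & B < p.1%:R + p.2^-1]]).

Definition t1t2_WT (t1 t2 : R) : Prop :=
  (fun p : nat * R => (lne (info_complexity (T p.1) p.2)
      / (p.1%:R `^ t1 + p.2 `^ (- t2))%:E)%E) @ large_s_inveps --> 0%E.

Definition WT : Prop := t1t2_WT 1 1.

Definition UWT : Prop :=
  forall t1 t2 : R, 0 < t1 <= 1 -> 0 < t2 <= 1 -> t1t2_WT t1 t2.

End Approximation.

(* Main.v *)
(* The eigenvalues of APP_s^* APP_s are omega^(sum_j a_j k(n_j)^(b_j)), so
   n(eps, APP_s) is the number of multi-indices n in N_0^s for which this exceeds
   eps^2.  If m_0 >= 2 there are m_0^s multi-indices with all k(n_j) = 0, and the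
   complexity grows exponentially in s.  If m_0 = 1, then k(n_j) = 0 only for
   n_j = 0; hence such a multi-index has at most l = O(log 1/eps) nonzero entries,
   each below some Y polynomial in log 1/eps, and there are at most (1 + s Y)^l of
   them, whose logarithm is O(1 + log^2 s + log^2 1/eps). *)

Require Import Defs.
From HB Require Import structures.
From mathcomp Require Import all_boot all_order all_algebra.
From mathcomp Require Import complex ring lra.
From mathcomp Require Import all_classical all_reals all_analysis.

Import Order.TTheory GRing.Theory Num.Theory.
Import numFieldNormedType.Exports.
Local Open Scope classical_set_scope.
Local Open Scope ring_scope.

(** * Transfer between [R] and the scalar field *)

Definition sof (R : realType) (F : scalarKind) : R -> scalarField R F :=
  match F return R -> scalarField R F with
  | RealScalars => idfun
  | ComplexScalars => fun x => (x%:C)%C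
  end.
Arguments sof {R} F x.

Section Scalars.
Context {R : realType} {F : scalarKind}.
Implicit Types (x y : R) (z w : scalarField R F).

Lemma sofK x : sreal (sof F x) = x.
Proof. by case: F. Qed.

(** In the order of [R[i]], [0 <= z] forces the imaginary part to vanish, so no information is
    lost. *)
Lemma srealK z : 0 <= z -> sof F (sreal z) = z.
Proof.
case: F z => //= -[x y]; rewrite lecE /= => /andP[/eqP -> _].
by [].
Qed.

Lemma ler_sof x y : (sof F x <= sof F y) = (x <= y).
Proof. by case: F => //=; rewrite lecR. Qed.

Lemma ltr_sof x y : (sof F x < sof F y) = (x < y).
Proof. by rewrite !lt_leAnge !ler_sof. Qed.

Lemma sofD x y : sof F (x + y) = sof F x + sof F y.
Proof. by case: F => //=; rewrite rmorphD. Qed.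

Lemma sofM x y : sof F (x * y) = sof F x * sof F y.
Proof. by case: F => //=; rewrite rmorphM. Qed.

Lemma sof0 : sof F (0 : R) = 0.
Proof. by case: F. Qed.

Lemma sof1 : sof F (1 : R) = 1.
Proof. by case: F. Qed.

(** Norm identities in [R] are obtained by pushing both sides into the scalar field, where the norms
    live. *)
Lemma sof_inj : injective (sof F : R -> _).
Proof. exact: can_inj sofK. Qed.

Lemma sofX x n : sof F (x ^+ n) = sof F x ^+ n.
Proof. by elim: n => [|n IH]; rewrite ?sof1 // !exprS sofM IH. Qed.

Lemma sof_sabs z : sof F (sabs z) = `|z|.
Proof. by rewrite srealK. Qed.

Lemma sabs_ge0 z : 0 <= sabs z.
Proof. by rewrite -ler_sof sof_sabs sof0. Qed.

Lemma sabs0 : sabs (0 : scalarField R F) = 0.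
Proof. by apply: sof_inj; rewrite sof_sabs normr0 sof0. Qed.

Lemma sabs_sof x : 0 <= x -> sabs (sof F x) = x.
Proof. by move=> x0; apply: sof_inj; rewrite sof_sabs ger0_norm // -sof0 ler_sof. Qed.

Lemma sconj0 : sconj (0 : scalarField R F) = 0.
Proof. by case: F => //=; rewrite oppr0. Qed.

End Scalars.

(** * Real-valued norms and Pythagoras *)

Section Hilbert.
Context {R : realType} {F : scalarKind} {H : hilbertSpace R F}.
Implicit Types (f g : H) (c : scalarField R F).

Lemma sof_hnorm f : sof F (hnorm f) = `|f|.
Proof. by rewrite srealK. Qed.

Lemma hnorm_ge0 f : 0 <= hnorm f.
Proof. by rewrite -(@ler_sof _ F) sof_hnorm sof0. Qed.

Lemma hnorm_eq0 f : (hnorm f == 0) = (f == 0).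
Proof. by rewrite -(inj_eq (@sof_inj _ F)) sof_hnorm sof0 normr_eq0. Qed.

Lemma hnorm0 : hnorm (0 : H) = 0.
Proof. by apply/eqP; rewrite hnorm_eq0. Qed.

Lemma hnorm_sqr f : sof F (hnorm f ^+ 2) = hdot H f f.
Proof. by rewrite sofX sof_hnorm hdotE. Qed.

Lemma ler_hnormD f g : hnorm (f + g) <= hnorm f + hnorm g.
Proof. by rewrite -(@ler_sof _ F) sofD !sof_hnorm ler_normD. Qed.

Lemma hnormZ c f : hnorm (c *: f) = sabs c * hnorm f.
Proof. by apply: (@sof_inj _ F); rewrite sofM sof_sabs !sof_hnorm normrZ. Qed.

Lemma hnormC f g : hnorm (f - g) = hnorm (g - f).
Proof. by apply: (@sof_inj _ F); rewrite !sof_hnorm distrC. Qed.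

Lemma hdotC f g : hdot H f g = sconj (hdot H g f).
Proof. by rewrite hermitian_subproof expr0 mul1r. Qed.

Lemma hdot0C f g : hdot H f g = 0 -> hdot H g f = 0.
Proof. by move=> fg; rewrite hdotC fg sconj0. Qed.

Lemma hnorm_pythagoras f g : hdot H f g = 0 ->
  hnorm (f + g) ^+ 2 = hnorm f ^+ 2 + hnorm g ^+ 2.
Proof.
move=> fg; apply: (@sof_inj _ F); rewrite sofD !hnorm_sqr.
rewrite linearDl /= !linearDr /= fg (hdot0C _ _ fg).
by rewrite addr0 add0r.
Qed.

Lemma cvg_hnormP (u : nat -> H) (f : H) : u @ \oo --> f ->
  forall d, 0 < d -> exists n, hnorm (u n - f) < d.
Proof.
move=> uf d d0; have d0' : 0 < sof F d by rewrite -sof0 ltr_sof.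
move/cvgrPdist_lt: uf => /(_ _ d0') [n _ un].
exists n; rewrite -(@ltr_sof _ F) sof_hnorm distrC; exact: (un n (leqnn n)).
Qed.

Lemma dense_hnormP (A : set H) : dense A ->
  forall (f : H) d, 0 < d -> exists2 g, A g & hnorm (g - f) < d.
Proof.
move=> Ad f d d0; have d0' : 0 < sof F d by rewrite -sof0 ltr_sof.
have [|g [fg Ag]] := Ad (ball f (sof F d)) _ (ball_open _ _).
  by exists f; apply: ballxx.
exists g => //; rewrite -(@ltr_sof _ F) sof_hnorm distrC.
by move: fg; rewrite -ball_normE.
Qed.

End Hilbert.

(** * Orthonormal expansions *)

Definition orthonormal_family {R : realType} {F : scalarKind}
    {H : hilbertSpace R F} {I : choiceType} (b : I -> H) : Prop :=
  forall i j, hdot H (b i) (b j) = (i == j)%:R.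

Definition partial_expansion {R : realType} {F : scalarKind}
    {H : hilbertSpace R F} {I : choiceType} (b : I -> H) (S : seq I) (f : H) : H :=
  \sum_(i <- S) hdot H f (b i) *: b i.

(** Unconditional convergence along finite index sets: multi-indices carry no preferred enumeration,
    and every larger [S'] must work so that it can be made to contain a prescribed set. *)
Definition expandable {R : realType} {F : scalarKind}
    {H : hilbertSpace R F} {I : choiceType} (b : I -> H) (f : H) : Prop :=
  forall d : R, 0 < d -> exists S : seq I, forall S' : seq I,
    uniq S' -> {subset S <= S'} -> hnorm (f - partial_expansion b S' f) < d.

Section Orthonormal.
Context {R : realType} {F : scalarKind} {H : hilbertSpace R F} {I : choiceType}.
Variable b : I -> H.
Hypothesis b_on : orthonormal_family b.
Implicit Types (f g : H) (S : seq I).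

Lemma hdot_comb S (c : I -> scalarField R F) j : uniq S ->
  hdot H (\sum_(i <- S) c i *: b i) (b j) = if j \in S then c j else 0.
Proof.
move=> uS; rewrite linear_sumlz.
under eq_bigr => i _ do rewrite linearZl_LR /= b_on.
have [jS|jS] := ifPn.
  rewrite (bigD1_seq j) //= eqxx mulr1 big1 ?addr0 // => i /negbTE ->.
  by rewrite mulr0.
rewrite big_seq big1 // => i iS; case: eqP => [ij|]; last by rewrite mulr0.
by rewrite -ij iS in jS.
Qed.

Lemma hdot_sum0r f S (c : I -> scalarField R F) :
  {in S, forall i, hdot H f (b i) = 0} -> hdot H f (\sum_(i <- S) c i *: b i) = 0.
Proof.
move=> f0; rewrite linear_sumr big_seq big1 // => i iS.
by rewrite linearZr_LR /= f0 // mulr0.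
Qed.

Lemma hnorm_comb_sqr S (c : I -> scalarField R F) : uniq S ->
  hnorm (\sum_(i <- S) c i *: b i) ^+ 2 = \sum_(i <- S) sabs (c i) ^+ 2.
Proof.
elim: S => [_|i S IH] /=.
  by rewrite !big_nil hnorm0 expr0n.
move=> /andP[iS uS]; rewrite !big_cons hnorm_pythagoras.
  rewrite IH // hnormZ; congr (_ + _).
  have -> : hnorm (b i) = 1.
    apply/eqP; rewrite -(@eqrXn2 _ 2) ?hnorm_ge0 // expr1n; apply/eqP.
    by apply: (@sof_inj _ F); rewrite hnorm_sqr b_on eqxx sof1.
  by rewrite mulr1.
rewrite hdot_sum0r // => j jS; rewrite linearZl_LR /= b_on.
by case: eqP iS => [->|]; rewrite ?jS ?mulr0.
Qed.

(** The residual is orthogonal to each [b i] with [i] in [S], so Pythagoras applies. *)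
Lemma hnorm_expansion_split S f : uniq S ->
  hnorm f ^+ 2 =
    hnorm (f - partial_expansion b S f) ^+ 2 + \sum_(i <- S) sabs (hdot H f (b i)) ^+ 2.
Proof.
move=> uS; rewrite -hnorm_comb_sqr // -hnorm_pythagoras ?subrK //.
apply: hdot_sum0r => i iS.
by rewrite linearBl /= hdot_comb // iS subrr.
Qed.

Lemma bessel S f : uniq S ->
  \sum_(i <- S) sabs (hdot H f (b i)) ^+ 2 <= hnorm f ^+ 2.
Proof. by move=> uS; rewrite (@hnorm_expansion_split S f uS) lerDr sqr_ge0. Qed.

Lemma hnorm_residual S f : uniq S -> hnorm (f - partial_expansion b S f) <= hnorm f.
Proof.
move=> uS; rewrite -(@ler_pXn2r _ 2) ?nnegrE ?hnorm_ge0 //.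
rewrite (@hnorm_expansion_split S f uS) lerDl sumr_ge0 // => i _.
exact: sqr_ge0.
Qed.

Lemma partial_expansionP S c f g :
  partial_expansion b S (c *: f + g) =
    c *: partial_expansion b S f + partial_expansion b S g.
Proof.
rewrite /partial_expansion scaler_sumr -big_split; apply: eq_bigr => i _.
by rewrite linearDl linearZl_LR /= scalerDl scalerA.
Qed.

Lemma expandable_basis i : expandable b (b i).
Proof.
move=> d d0; exists [:: i] => S' uS' iS'.
have iS : i \in S' by apply: iS'; rewrite inE.
rewrite /partial_expansion (bigD1_seq i) //= b_on eqxx scale1r.
rewrite big1 ?addr0 ?subrr; last by move=> j ji; rewrite b_on eq_sym (negbTE ji) scale0r.
by rewrite hnorm0.
Qed.

Lemma expandable_linear c f g :
  expandable b f -> expandable b g -> expandable b (c *: f + g).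
Proof.
move=> ef eg d d0.
(* Dividing by [1 + sabs c] instead of [sabs c] covers the case [c = 0]. *)
have c1 : 0 < 1 + sabs c by rewrite ltr_pwDl // sabs_ge0.
have [|Sf Hf] := ef (d / 2 / (1 + sabs c)); first by rewrite !divr_gt0.
have [|Sg Hg] := eg (d / 2); first by rewrite divr_gt0.
exists (Sf ++ Sg) => S' uS' sub.
have {}Hf : hnorm (f - partial_expansion b S' f) <= d / 2 / (1 + sabs c).
  by apply/ltW/Hf => // i iS; apply: sub; rewrite mem_cat iS.
have {}Hg : hnorm (g - partial_expansion b S' g) < d / 2.
  by apply: Hg => // i iS; apply: sub; rewrite mem_cat iS orbT.
rewrite partial_expansionP opprD addrACA -scalerBr.
apply: (le_lt_trans (ler_hnormD _ _)); rewrite hnormZ (splitr d).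
apply: ler_ltD => //.
apply: (@le_trans _ _ ((1 + sabs c) * (d / 2 / (1 + sabs c)))).
  by apply: ler_pM; rewrite ?sabs_ge0 ?hnorm_ge0 ?lerDr.
by rewrite mulrC divfK // gt_eqF.
Qed.

Lemma expandable0 : expandable b 0.
Proof.
move=> d d0; exists [::] => S' uS' _.
have := hnorm_residual S' 0 uS'.
by rewrite hnorm0 => /le_lt_trans; apply.
Qed.

Lemma expandable_sum J (r : seq J) (c : J -> scalarField R F) (f : J -> H) :
  (forall j, expandable b (f j)) -> expandable b (\sum_(j <- r) c j *: f j).
Proof.
move=> ef; elim: r => [|j r IH]; first by rewrite big_nil; exact: expandable0.
by rewrite big_cons; apply: expandable_linear.
Qed.

Lemma expandable_lim f :
  (forall d, 0 < d -> exists2 g, expandable b g & hnorm (g - f) < d) -> expandable b f.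
Proof.
move=> lim d d0; have d2 : 0 < d / 2 by rewrite divr_gt0.
have [g eg gf] := lim _ d2; have [S HS] := eg _ d2; exists S => S' uS' sub.
(* The set found for [g] also serves [f]: the residual of [f - g] is bounded by [hnorm (f - g)]
   whatever [S'] is. *)
have -> : f - partial_expansion b S' f =
    (f - g - partial_expansion b S' (f - g)) + (g - partial_expansion b S' g).
  rewrite -{1 2}(subrK g f) -{2}[f - g]scale1r.
  by rewrite partial_expansionP !scale1r opprD addrACA.
apply: (le_lt_trans (ler_hnormD _ _)); rewrite (splitr d); apply: ltrD.
  by apply: (le_lt_trans (hnorm_residual _ _ uS')); rewrite hnormC.
exact: HS.
Qed.

End Orthonormal.

(** * The tensor product basis *)

Section TensorBasis.
Context {R : realType} {F : scalarKind} {H : hilbertSpace R F} {s : nat}.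
Variables (e : nat -> H) (T : tensorPower H s).
Hypothesis e_basis : orthonormal_basis e.

Lemma hnorm_tens (u : 'I_s -> H) : hnorm (tens T u) = \prod_(i < s) hnorm (u i).
Proof.
apply/eqP; rewrite -(@eqrXn2 _ 2) ?hnorm_ge0 ?prodr_ge0 // => [|i _]; last exact: hnorm_ge0.
apply/eqP/(@sof_inj _ F); rewrite hnorm_sqr tens_dot -prodrXl.
rewrite (big_morph (sof F) (@sofM R F) (@sof1 R F)).
by apply: eq_bigr => i _; rewrite hnorm_sqr.
Qed.

Lemma tens_dfwith0 (u : 'I_s -> H) i : tens T (dfwith u i 0) = 0.
Proof.
have := @tens_multilinear _ _ _ _ T u i (-1) 0 0.
by rewrite scaler0 addr0 scaleN1r addNr.
Qed.

Lemma tens_dfwith_sum (u : 'I_s -> H) i n (c : 'I_n -> scalarField R F) (x : 'I_n -> H) :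
  tens T (dfwith u i (\sum_(k < n) c k *: x k)) =
    \sum_(k < n) c k *: tens T (dfwith u i (x k)).
Proof.
elim/big_rec2: _ => [|k y z _ <-]; first exact: tens_dfwith0.
exact: tens_multilinear.
Qed.

Lemma hnorm_tens_dfwithB (u : 'I_s -> H) i x y :
  hnorm (tens T (dfwith u i x) - tens T (dfwith u i y)) =
    hnorm (x - y) * \prod_(j < s | j != i) hnorm (u j).
Proof.
have -> : tens T (dfwith u i x) - tens T (dfwith u i y) = tens T (dfwith u i (x - y)).
  have := @tens_multilinear _ _ _ _ T u i (-1) y x.
  by rewrite !scaleN1r addrC [in RHS]addrC.
rewrite hnorm_tens (bigD1 i) //= dfwithin; congr (_ * _).
by apply: eq_bigr => j ji; rewrite dfwithout // eq_sym.
Qed.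

Lemma tbasis_orthonormal : orthonormal_family (tbasis e T).
Proof.
move=> n n'; rewrite tens_dot (eq_bigr (fun i => (n i == n' i)%:R)).
  rewrite -natr_prod; case: eqP => [->|nn'].
    by rewrite big1 // => i _; rewrite eqxx.
  have [i ni] : exists i, n i != n' i.
    apply/existsP; apply: contra_notT nn' => /existsPn h.
    by apply/ffunP => i; apply/eqP; move: (h i); rewrite negbK.
  by rewrite (bigD1 i) //= (negbTE ni) mul0n.
by move=> i _; case: e_basis => -> _.
Qed.

(* The factors are freed one at a time: [k] of them are arbitrary, the others
   are basis vectors. *)
Lemma expandable_tens k (u : 'I_s -> H) :
  (forall j : 'I_s, (k <= j)%N -> exists l, u j = e l) ->
  expandable (tbasis e T) (tens T u).
Proof.
elim: k u => [|k IH] u hu.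
  have /choice[l hl] : forall j, exists l, u j = e l by move=> j; exact: hu.
  have -> : tens T u = tbasis e T [ffun j => l j].
    by congr tens; apply/funext => j; rewrite hl ffunE.
  exact: expandable_basis _ tbasis_orthonormal _.
have [ks|sk] := ltnP k s; last first.
  by apply: IH => j kj; have := leq_trans (ltn_ord j) (leq_trans sk kj); rewrite ltnn.
pose i := Ordinal ks.
have ex l : expandable (tbasis e T) (tens T (dfwith u i (e l))).
  apply: IH => j; rewrite leq_eqVlt => /orP[/eqP kj|/[dup] kj /hu[l' ujl]].
    have -> : j = i by apply/val_inj.
    by exists l; rewrite dfwithin.
  exists l'; rewrite dfwithout // -?ujl //.
  by apply: contraTneq kj => <-; rewrite ltnn.
(* Factor [i] is replaced by a partial sum of its basis expansion. The tensor moves by that error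
   times [C]; [1 + C] guards against a vanishing factor. *)
apply: (expandable_lim _ tbasis_orthonormal) => d d0.
pose C := \prod_(j < s | j != i) hnorm (u j).
have C0 : 0 < 1 + C by rewrite ltr_pwDl // prodr_ge0 // => j _; exact: hnorm_ge0.
case: e_basis => _ /(_ (u i))/cvg_hnormP/(_ (d / (1 + C))).
rewrite divr_gt0 // => /(_ isT)[n hn].
exists (tens T (dfwith u i (\sum_(l < n) hdot H (u i) (e l) *: e l))).
  rewrite tens_dfwith_sum; apply: (expandable_sum _ tbasis_orthonormal) => l.
  exact: ex.
have -> : tens T u = tens T (dfwith u i (u i)).
  congr tens; apply/funext => j; have [->|ji] := eqVneq j i; first by rewrite dfwithin.
  by rewrite dfwithout // eq_sym.
rewrite hnorm_tens_dfwithB -/C.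
apply: (@le_lt_trans _ _ (hnorm (\sum_(l < n) hdot H (u i) (e l) *: e l - u i) * (1 + C))).
  by rewrite ler_wpM2l ?hnorm_ge0 // lerDr.
by rewrite -ltr_pdivlMr.
Qed.

(** Elementary tensors are expandable (all [s] factors free), their span is dense, and expandability
    survives limits. *)
Lemma tbasis_expandable (f : T) : expandable (tbasis e T) f.
Proof.
apply: (expandable_lim _ tbasis_orthonormal) => d d0.
have [_ [n [c [u ->]]] gf] := dense_hnormP _ (@tens_dense _ _ _ _ T) f d d0.
exists (\sum_(i < n) c i *: tens T (u i)) => //.
apply: (expandable_sum _ tbasis_orthonormal) => i.
apply: (@expandable_tens s) => j sj.
by have := leq_trans (ltn_ord j) sj; rewrite ltnn.
Qed.

End TensorBasis.

(** * Worst-case errors *)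

(** The power of omega with this exponent is the eigenvalue of the embedding's singular value
    problem at the basis tensor [n]. *)
Definition exponent {R : realType} (m : nat -> nat) (a b : nat -> R) {s : nat}
  (n : {ffun 'I_s -> nat}) : R := \sum_(j < s) a j * (blockidx m (n j))%:R `^ b j.

Section FixedDimension.
Context {R : realType} {F : scalarKind} {H : hilbertSpace R F} {s : nat}.
Variables (e : nat -> H) (omega : R) (m : nat -> nat) (a b : nat -> R).
Variable T : tensorPower H s.
Hypotheses (e_basis : orthonormal_basis e) (omega_itv : 0 < omega < 1).
Hypothesis a_ge0 : forall j, 0 <= a j.
Implicit Types (f g : T) (n : {ffun 'I_s -> nat}).

Local Notation wnorm := (wnorm e omega m a b).
Local Notation weight n := (omega `^ (- exponent m a b n)).
Local Notation coord f n := (hdot T f (tbasis e T n)).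

Lemma weight_ge1 n : 1 <= weight n.
Proof.
have /andP[w0 w1] := omega_itv.
have h : 0 <= exponent m a b n by apply: sumr_ge0 => j _; rewrite mulr_ge0 ?powR_ge0.
by rewrite -(powRr0 omega) ger_powR ?oppr_le0 // w0 ltW.
Qed.

(** An [esum] of nonnegative terms is a supremum of finite sums, so later arguments handle finite
    sums only. *)
Lemma wnorm_leP f (r : R) : 0 <= r ->
  (wnorm f <= r%:E)%E <->
  (forall X : seq {ffun 'I_s -> nat}, uniq X ->
     \sum_(n <- X) weight n * sabs (coord f n) ^+ 2 <= r ^+ 2).
Proof.
move=> r0; have re : (r%:E = sqrte (r ^+ 2)%:E)%E by rewrite /= sqrtr_sqr ger0_norm.
rewrite re lee_sqrt ?lee_fin ?sqr_ge0 //; split => [h X uX|h].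
  rewrite -lee_fin; apply: le_trans h; apply: esum_ge.
  exists [set` X]; first by split => //; exact: finite_seq.
  by rewrite -fsbig_seq // sumEFin.
apply: ge_ereal_sup => _ [X [finX _] <-].
by rewrite fsbig_finite //= sumEFin lee_fin h // finmap.fset_uniq.
Qed.

(** A single term of the weighted sum already dominates the squared coordinate, because its weight
    is at least 1. *)
Lemma coord_continuous n : continuous_functional e omega m a b (fun f => coord f n).
Proof.
split=> [c f g _ _|f _ d d0]; first by rewrite linearDl linearZl_LR.
exists d => // g _; rewrite -linearBl.
have : (0 <= wnorm (g - f)%R)%E by exact: sqrte_ge0.
case E : (wnorm (g - f)) => [r| |] //; rewrite lee_fin lte_fin => r0; apply: le_lt_trans.
have /(wnorm_leP _ _ r0)/(_ [:: n] isT) : (wnorm (g - f)%R <= r%:E)%E by rewrite E.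
rewrite big_seq1 => h; rewrite -(@ler_pXn2r _ 2) ?nnegrE ?sabs_ge0 //.
by apply: le_trans h; rewrite ler_peMl ?sqr_ge0 // weight_ge1.
Qed.

(** The algorithm truncates the expansion to [S]. Outside [S] each squared coordinate is at most
    eps^2 times its weighted version, and these sum to at most 1 over the unit ball. *)
Lemma min_error_le (eps : R) (S : seq {ffun 'I_s -> nat}) : 0 < eps -> uniq S ->
  (forall n, n \notin S -> eps ^- 2 <= weight n) ->
  (min_error e omega m a b T (size S) <= eps%:E)%E.
Proof.
move=> eps0 uS largeS; apply: ge_ereal_inf.
pose nS j := nth [ffun=> 0%N] S j.
exists (worst_error e omega m a b
  (fun f : T => \sum_(j < size S) coord f (nS j) *: tbasis e T (nS j))).
  exists (fun f : T => \sum_(j < size S) coord f (nS j) *: tbasis e T (nS j)) => //.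
  exists (fun j f => coord f (nS j)), (fun j => tbasis e T (nS j)).
  by split=> // j; exact: coord_continuous.
apply: ge_ereal_sup => _ [f wf <-]; rewrite lee_fin.
have -> : \sum_(j < size S) coord f (nS j) *: tbasis e T (nS j) =
    partial_expansion (tbasis e T) S f.
  by rewrite /partial_expansion (big_nth [ffun=> 0%N]) big_mkord.
apply/ler_addgt0Pr => d d0; have on := tbasis_orthonormal e T e_basis.
have [S0 HS0] := tbasis_expandable e T e_basis f d d0.
(* [S ++ S1] is duplicate-free and contains [S0]: the truncation error becomes a finite sum over
   [S1], bounded by [eps], plus a residual bounded by [d]. *)
pose S1 := [seq n <- undup S0 | n \notin S].
have uS1 : uniq S1 by rewrite filter_uniq ?undup_uniq.
have {HS0} := HS0 (S ++ S1).
rewrite cat_uniq uS uS1 andbT => /(_ _ _)/ltW HS0.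
have -> : f - partial_expansion (tbasis e T) S f =
    partial_expansion (tbasis e T) S1 f + (f - partial_expansion (tbasis e T) (S ++ S1) f).
  by rewrite /partial_expansion big_cat /= opprD addrCA [X in _ + (_ + X)]addrC addNKr.
apply: (le_trans (ler_hnormD _ _)); apply: lerD; last first.
  apply: HS0 => [|n nS0]; first by apply/hasPn => n; rewrite mem_filter => /andP[].
  by rewrite mem_cat mem_filter mem_undup nS0 andbT orbN.
rewrite -(@ler_pXn2r _ 2) ?nnegrE ?hnorm_ge0 ?(ltW eps0) // hnorm_comb_sqr //.
have {}wf := (wnorm_leP f 1 ler01).1 wf S1 uS1.
rewrite expr1n -(ler_pM2l (exprn_gt0 2 eps0)) mulr1 in wf; apply: le_trans wf.
rewrite mulr_sumr big_seq [leRHS]big_seq; apply: ler_sum => n.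
rewrite mem_filter => /andP[/largeS nS1 _].
rewrite mulrA ler_peMl ?sqr_ge0 //.
by rewrite mulrC -ler_pdivrMr ?exprn_gt0 // mul1r.
Qed.

(** Vectors supported where the weight is 1, that is, in the eigenspace for the largest eigenvalue
    1. *)
Definition flat f : Prop := forall n, coord f n != 0 -> exponent m a b n = 0.

Lemma flat_wnorm f : flat f -> (wnorm f <= (hnorm f)%:E)%E.
Proof.
move=> ff; apply/wnorm_leP => [|X uX]; first exact: hnorm_ge0.
apply: (le_trans _ (bessel _ (tbasis_orthonormal e T e_basis) _ f uX)).
apply: ler_sum => n _; have [->|/ff ->] := eqVneq (coord f n) 0.
  by rewrite sabs0 expr0n mulr0.
by rewrite oppr0 powRr0 mul1r.
Qed.

Lemma flat_wspace f : flat f -> wspace e omega m a b f.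
Proof. by move=> /flat_wnorm/le_lt_trans; apply; rewrite ltry. Qed.

Lemma flatP c f g : flat f -> flat g -> flat (c *: f + g).
Proof.
move=> ff fg n; rewrite linearDl linearZl_LR /=.
have [->|/ff //] := eqVneq (coord f n) 0.
by rewrite mulr0 add0r => /fg.
Qed.

Lemma flat0 : flat 0.
Proof. by move=> n; rewrite linear0l eqxx. Qed.

(** [L] is linear on [wspace] only, so flatness of the partial sums is carried through the
    induction. *)
Lemma functional_sum (L : T -> scalarField R F) k
    (c : 'I_k -> scalarField R F) (f : 'I_k -> T) :
  continuous_functional e omega m a b L -> (forall i, flat (f i)) ->
  flat (\sum_(i < k) c i *: f i) /\
  L (\sum_(i < k) c i *: f i) = \sum_(i < k) c i * L (f i).
Proof.
move=> [linL _] ff; elim/big_rec2: _ => [|i y g _ [fg <-]].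
  split; first exact: flat0.
  have := linL 1 0 0 (flat_wspace _ flat0) (flat_wspace _ flat0).
  by rewrite scale1r mul1r addr0 => /eqP; rewrite addrC -subr_eq subrr eq_sym => /eqP.
by split; [exact: flatP | rewrite linL //; exact: flat_wspace].
Qed.

(* On the span of the [k] flat basis vectors the two norms agree, and fewer than
   [k] functionals have a common unit zero there. *)
Lemma min_error_ge1 k (idx : 'I_k -> {ffun 'I_s -> nat}) d : injective idx ->
  (forall i, exponent m a b (idx i) = 0) -> (d < k)%N ->
  (1 <= min_error e omega m a b T d)%E.
Proof.
move=> idx_inj idx0 dk; have on := tbasis_orthonormal e T e_basis.
apply: le_ereal_inf_tmp => _ [A [L [g [contL ->]]] <-].
(* The rank is at most [d < k], so some nonzero row vector [v] kills [M]; its entries are the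
   coefficients of a common zero of all [L j]. *)
pose M : 'M[scalarField R F]_(k, d) := \matrix_(i, j) L j (tbasis e T (idx i)).
have : kermx M != 0.
  rewrite kermx_eq0 /row_free; apply: contraTneq dk => <-.
  by rewrite -leqNgt rank_leq_col.
case/rowV0Pn => v /sub_kermxP vM v0.
have flat_basis i : flat (tbasis e T (idx i)).
  by move=> n; rewrite on; case: (idx i =P n) => [<- //|_]; rewrite eqxx.
pose f := \sum_(i < k) v 0 i *: tbasis e T (idx i).
have ff : flat f.
  rewrite /f; elim/big_rec: _ => [|i h _ fh]; [exact: flat0|exact: flatP].
have Lf j : L j f = 0.
  have [_ ->] := functional_sum (L j) k (v 0) _ (contL j) flat_basis.
  have /rowP/(_ j) := vM; rewrite !mxE => vMj; rewrite -[RHS]vMj.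
  by apply: eq_bigr => i _; rewrite mxE.
have f0 : hnorm f != 0.
  rewrite hnorm_eq0; have /existsP[i vi] : [exists i, v 0 i != 0].
    apply: contra_neqT v0 => /existsPn vz; apply/rowP => i.
    by rewrite mxE; apply/eqP; move: (vz i); rewrite negbK.
  apply: contra_neq vi => /(congr1 (fun h => coord h (idx i))).
  rewrite linear0l /f linear_sumlz (bigD1 i) //= linearZl_LR /= on eqxx mulr1.
  rewrite big1 ?addr0 // => j ji; rewrite linearZl_LR /= on (inj_eq idx_inj) (negbTE ji).
  by rewrite mulr0.
pose h := sof F (hnorm f)^-1 *: f.
have h1 : hnorm h = 1.
  by rewrite hnormZ sabs_sof ?invr_ge0 ?hnorm_ge0 // mulVf.
have fh : flat h by rewrite -[h]addr0; apply: flatP => //; exact: flat0.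
have Lh j : L j h = 0.
  have [_] := functional_sum (L j) 1 (fun=> sof F (hnorm f)^-1) (fun=> f) (contL j) (fun=> ff).
  by rewrite !big_ord1 Lf mulr0.
(* The algorithm sends the unit vector [h] to 0, so its error at [h] is 1. *)
apply: ereal_sup_ubound; exists h.
  by rewrite /= -h1; exact: flat_wnorm.
by rewrite big1 ?subr0 ?h1 // => j _; rewrite Lh scale0r.
Qed.

End FixedDimension.

(** * Counting multi-indices *)

Section Blocks.
Variable m : nat -> nat.
Hypothesis m_gt0 : forall k, (0 < m k)%N.

Lemma rblockS k : rblock m k.+1 = (rblock m k + m k)%N.
Proof. by rewrite /rblock big_ord_recr. Qed.

Lemma leq_rblock k : (k <= rblock m k)%N.
Proof.
elim: k => // k IH; rewrite rblockS -addn1.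
exact: leq_add IH (m_gt0 k).
Qed.

(** The least [k] with [n < rblock m k.+1] is admissible, so [xget] does not fall back on its
    default 0. Positivity of the block ends makes the truncated predecessor exact. *)
Lemma blockidxP n : (rblock m (blockidx m n) <= n < rblock m (blockidx m n).+1)%N.
Proof.
have rp k : (rblock m k.+1).-1.+1 = rblock m k.+1.
  by rewrite prednK // (leq_trans _ (leq_rblock _)).
have [] : [set k : nat | (rblock m k <= n <= (rblock m k.+1).-1)%N] (blockidx m n).
  apply: xgetPex; have ex : exists k, (n < rblock m k.+1)%N by exists n; exact: leq_rblock.
  exists (ex_minn ex); case: ex_minnP => k nk kmin /=.
  rewrite -(ltnS n) rp nk andbT; case: k nk kmin => [|k] _ kmin; first by rewrite /rblock big_ord0.
  by rewrite leqNgt; apply/negP => /kmin; rewrite ltnn.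
by rewrite /= -(ltnS n) rp.
Qed.

Lemma blockidx_eq0 n : (n < m 0)%N -> blockidx m n = 0%N.
Proof.
have /andP[kn _] := blockidxP n; case: (blockidx m n) kn => // k.
rewrite /rblock big_ord_recl /= => kn nm.
by have := leq_ltn_trans (leq_trans (leq_addr _ _) kn) nm; rewrite ltnn.
Qed.

(** When m_0 = 1, block 0 is the singleton of 0. *)
Lemma blockidx_gt0 n : m 0 = 1%N -> (0 < n)%N -> (0 < blockidx m n)%N.
Proof.
move=> m0 n0; have /andP[_] := blockidxP n.
case: (blockidx m n) => //; rewrite rblockS /rblock big_ord0 m0.
by case: n n0.
Qed.

Lemma ltn_blockidx M n : (forall k, m k <= M)%N -> (n < M * (blockidx m n).+1)%N.
Proof.
move=> mM; have /andP[_ nk] := blockidxP n; apply: (leq_trans nk).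
rewrite mulnC -[in leqRHS](card_ord (blockidx m n).+1) -sum_nat_const /rblock.
exact: leq_sum.
Qed.

End Blocks.

(* Contains every multi-index with entries below [Y] and at most [l] of them
   nonzero. *)
Fixpoint sparse (s Y l : nat) : seq {ffun 'I_s -> nat} :=
  if l is l'.+1 then
    sparse s Y l' ++
    [seq [ffun i => if i == p.1 then p.2 else n i] |
       n : {ffun 'I_s -> nat} <- sparse s Y l', p <- [seq (j, v) | j <- enum 'I_s, v <- iota 0 Y]]
  else [:: [ffun=> 0%N]].

Lemma size_sparse s Y l : size (sparse s Y l) = ((1 + s * Y) ^ l)%N.
Proof.
elim: l => //= l IH; rewrite size_cat !size_allpairs size_iota size_enum_ord IH.
by rewrite expnSr mulnDr muln1.
Qed.

(** Induction on [l]: zeroing one nonzero entry [j] lowers the count by one, and the update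
    [(j, n j)] restores [n]. *)
Lemma mem_sparse s Y l (n : {ffun 'I_s -> nat}) :
  (forall j, n j < Y)%N -> (#|[pred j | n j != 0%N]| <= l)%N -> n \in sparse s Y l.
Proof.
elim: l n => [|l IH] n nY.
  rewrite leqn0 => /eqP/card0_eq n0; rewrite /= inE; apply/eqP/ffunP => j.
  by rewrite ffunE; apply/eqP; have := n0 j; rewrite !inE => /negbT; rewrite negbK.
rewrite /= mem_cat => nl.
have [/existsP[j jn]|/existsPn n0] := boolP [exists j, n j != 0%N]; last first.
  by rewrite IH // eq_card0 // => j; rewrite inE; apply/negbTE/n0.
apply/orP; right; apply/allpairsP.
exists ([ffun i => if i == j then 0%N else n i], (j, n j)); split => /=.
- apply: IH => [i|]; first by rewrite ffunE; case: eqP => // _; exact: leq_ltn_trans (nY i).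
  move: nl; rewrite (cardD1 j) inE jn add1n ltnS; apply: leq_trans.
  apply: subset_leq_card; apply/fintype.subsetP => i; rewrite !inE ffunE.
  by case: (i =P j).
- apply/allpairsP; exists (j, n j); split => //=; first by rewrite mem_enum.
  by rewrite mem_iota add0n nY.
- by apply/ffunP => i; rewrite !ffunE; case: eqP => // ->.
Qed.

(** * Information complexity and tractability *)

Section InformationComplexity.
Context {R : realType} {F : scalarKind} {H : hilbertSpace R F}.
Variables (e : nat -> H) (omega : R) (m : nat -> nat) (a b : nat -> R).
Hypotheses (e_basis : orthonormal_basis e) (omega_itv : 0 < omega < 1).
Hypothesis m_gt0 : forall k, (0 < m k)%N.
Hypothesis a_gt0 : 0 < a 0%N.
Hypothesis a_mono : forall i j, (i <= j)%N -> a i <= a j.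
Hypothesis b_gt0 : forall j, 0 < b j.

Let a_ge j : a 0%N <= a j.
Proof. exact: a_mono. Qed.

Let a_ge0 j : 0 <= a j.
Proof. exact: le_trans (ltW a_gt0) (a_ge j). Qed.

(** The m_0^s multi-indices with all entries below m_0 have exponent 0, so fewer functionals leave
    an error of at least 1, which exceeds [eps]. *)
Lemma info_complexity_ge s (T : tensorPower H s) (eps : R) : eps < 1 ->
  (((m 0 ^ s)%N%:R : R)%:E <= info_complexity e omega m a b T eps)%E.
Proof.
move=> eps1; apply: le_ereal_inf_tmp => _ [d /= ed <-].
rewrite lee_fin ler_nat leqNgt; apply/negP => dk.
have kE : (m 0 ^ s)%N = #|{: {ffun 'I_s -> 'I_(m 0)}}| by rewrite card_ffun !card_ord.
rewrite kE in dk.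
pose idx (i : 'I_#|{: {ffun 'I_s -> 'I_(m 0)}}|) : {ffun 'I_s -> nat} :=
  [ffun j => (enum_val i : {ffun 'I_s -> 'I_(m 0)}) j : nat].
have idx_inj : injective idx.
  move=> i i' /ffunP ii'; apply: enum_val_inj; apply/ffunP => j; apply: val_inj.
  by have := ii' j; rewrite !ffunE.
have idx0 i : exponent m a b (idx i) = 0.
  rewrite /exponent big1 // => j _; rewrite ffunE blockidx_eq0 ?ltn_ord //.
  (* Positivity of [b j] matters: the power 0^0 would be 1. *)
  by rewrite powR0 ?mulr0 // gt_eqF.
have := min_error_ge1 e omega m a b T e_basis _ idx d idx_inj idx0 dk.
by move=> /le_trans/(_ ed); rewrite lee_fin leNgt eps1.
Qed.

Lemma info_complexity_ge1 s (T : tensorPower H s) (eps : R) : eps < 1 ->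
  (1 <= info_complexity e omega m a b T eps)%E.
Proof.
move=> eps1; apply: le_trans (info_complexity_ge s T eps eps1).
by rewrite lee_fin ler1n expn_gt0 m_gt0.
Qed.

Section UpperBound.
Hypothesis m0 : m 0 = 1%N.
Variable M : nat.
Hypothesis m_le : forall k, (m k <= M)%N.
Variable beta : R.
Hypotheses (beta_gt0 : 0 < beta) (b_ge : forall j, beta <= b j).

(** Each nonzero entry adds at least a_0 to the exponent, which bounds their number by z. Each block
    index satisfies k^beta <= z, which bounds the entries through the block size [M]. *)
Lemma mem_sparse_exponent s (n : {ffun 'I_s -> nat}) (z : R) : 0 <= z ->
  exponent m a b n <= a 0%N * z ->
  n \in sparse s (M * (Num.truncn (z `^ beta^-1)).+1) (Num.truncn z).
Proof.
move=> z0 nz.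
have term_ge0 (j : 'I_s) : 0 <= a j * (blockidx m (n j))%:R `^ b j.
  by rewrite mulr_ge0 ?a_ge0 ?powR_ge0.
have term_ge (j : 'I_s) : (blockidx m (n j))%:R `^ beta * a 0%N <=
    a j * (blockidx m (n j))%:R `^ b j.
  rewrite mulrC ler_pM ?powR_ge0 ?a_ge ?(ltW a_gt0) //.
  case: (blockidx m (n j)) => [|k]; first by rewrite powR0 ?powR_ge0 ?gt_eqF.
  by rewrite ler_powR ?ler1n.
apply: mem_sparse => [j|].
  apply: leq_trans (ltn_blockidx m m_gt0 M (n j) m_le) _.
  rewrite leq_mul2l ltnS truncn_ge_nat ?powR_ge0 //; apply/orP; right.
  have : (blockidx m (n j))%:R `^ beta <= z.
    rewrite -(ler_pM2r a_gt0) [leRHS]mulrC; apply: le_trans nz.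
    apply: le_trans (term_ge j) _.
    by rewrite /exponent (bigD1 j) //= lerDl sumr_ge0.
  move=> kz; have := ge0_ler_powR (ltW _) _ _ kz.
  move=> /(_ beta^-1); rewrite invr_gt0 => /(_ beta_gt0).
  by rewrite -powRrM mulfV ?gt_eqF // powRr1 ?ler0n //; apply; rewrite nnegrE ?powR_ge0.
rewrite truncn_ge_nat // -(ler_pM2l a_gt0) mulrC; apply: le_trans nz.
rewrite -sum1_card natr_sum mulr_suml big_mkcond; apply: ler_sum => j _.
rewrite inE; case: ifPn => // nj; apply: le_trans (term_ge j); rewrite ler_pM2r //.
have k1 : (1 : R) <= (blockidx m (n j))%:R.
  by rewrite ler1n (blockidx_gt0 _ m_gt0) // lt0n.
by apply: le_trans (ler_powR k1 (ltW beta_gt0)); rewrite powRr0.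
Qed.

(** [z] is chosen so that omega^(-a_0 z) = eps^(-2): a weight below eps^(-2) forces an exponent of
    at most a_0 z. *)
Lemma info_complexity_le s (T : tensorPower H s) (eps : R) : 0 < eps < 1 ->
  let z := 2 * ln eps^-1 / (- ln omega * a 0%N) in
  (info_complexity e omega m a b T eps <=
   (((1 + s * (M * (Num.truncn (z `^ beta^-1)).+1)) ^ Num.truncn z)%N%:R : R)%:E)%E.
Proof.
move=> /andP[eps0 eps1] /=; set z := 2 * _ / _; have /andP[w0 w1] := omega_itv.
have c0 : 0 < - ln omega by rewrite oppr_gt0 ln_lt0 // w0.
have L0 : 0 <= ln eps^-1 by rewrite ln_ge0 // invf_ge1 // ltW.
have z0 : 0 <= z by rewrite divr_ge0 ?mulr_ge0 ?(ltW a_gt0) ?(ltW c0).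
set S := sparse s (M * (Num.truncn (z `^ beta^-1)).+1) (Num.truncn z).
(* [sparse] may list an index several times, so duplicates are removed before it serves as an index
   set. *)
apply: ge_ereal_inf; exists (size (undup S))%:R%:E; last first.
  by rewrite lee_fin ler_nat -size_sparse size_undup.
exists (size (undup S)) => //=.
apply: (min_error_le e omega m a b T e_basis omega_itv a_ge0) => //; first exact: undup_uniq.
move=> n; rewrite mem_undup; apply: contraNT; rewrite -ltNge => wn.
apply: mem_sparse_exponent => //; move: wn.
have -> : eps ^- 2 = expR (2 * ln eps^-1).
  by rewrite mulrC expRM_natr lnK ?posrE ?invr_gt0 // exprVn.
rewrite /powR gt_eqF // ltr_expR mulNr -mulrN => /ltW.
rewrite -ler_pdivlMr // => /le_trans; apply.
by rewrite [leRHS]mulrC /z invfM mulrA divfK // gt_eqF.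
Qed.

End UpperBound.
End InformationComplexity.

(** * Logarithm estimates *)

(** Apply ln y <= y to y = x^(t/4). *)
Lemma sqr_ln_le (R : realType) (t x : R) : 0 < t -> 1 <= x ->
  ln x ^+ 2 <= (4 / t) ^+ 2 * x `^ (t / 2).
Proof.
move=> t0 x1; have x0 : 0 < x by exact: lt_le_trans x1.
have xt0 : 0 < x `^ (t / 4) by exact: powR_gt0.
have -> : x `^ (t / 2) = (x `^ (t / 4)) ^+ 2.
  by rewrite -powR_mulrn ?powR_ge0 // -powRrM; congr (_ `^ _); field.
rewrite -exprMn ler_pXn2r ?nnegrE ?ln_ge0 ?mulr_ge0 ?invr_ge0 ?(ltW t0) ?powR_ge0 //.
have -> : ln x = 4 / t * ln (x `^ (t / 4)).
  by rewrite ln_powR; field; rewrite gt_eqF.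
by rewrite ler_pM2l ?divr_gt0 // ltW // ln_sublinear.
Qed.

Lemma ln_count_le (R : realType) (z gamma : R) (s M : nat) :
  0 <= z -> 0 <= gamma -> (0 < s)%N ->
  ln ((1 + s * (M * (Num.truncn (z `^ gamma)).+1)) ^ Num.truncn z)%N%:R <=
  z * (ln s%:R + ln (1 + 2 * M%:R) + gamma * z).
Proof.
move=> z0 g0 s0; set N := (1 + _)%N.
have N1 : (1 : R) <= N%:R by rewrite ler1n.
have s1 : (1 : R) <= s%:R by rewrite ler1n.
(* With base [1 + z], [q] is at least 1 and absorbs the successor, which is where the 2 in
   [1 + 2 * M] comes from; moreover ln (1 + z) <= z. *)
pose q := (1 + z) `^ gamma.
have q1 : 1 <= q by rewrite -(powRr0 (1 + z)) ler_powR // lerDl.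
have tq : (Num.truncn (z `^ gamma))%:R <= q.
  apply: le_trans (_ : z `^ gamma <= _); first by rewrite truncn_le powR_ge0.
  by rewrite ge0_ler_powR // ?nnegrE ?addr_ge0 // lerDr.
have Nle : N%:R <= s%:R * ((1 + 2 * M%:R) * q).
  rewrite /N natrD !natrM mulrDl mul1r mulrDr; apply: lerD.
    by apply: mulr_ege1.
  rewrite ler_wpM2l // mulrAC mulrC ler_wpM2r //.
  by rewrite -natr1 mulr2n mulrDl !mul1r lerD.
rewrite natrX lnXn ?(lt_le_trans ltr01) // -[leLHS]mulr_natl.
have lnN : ln N%:R <= ln s%:R + ln (1 + 2 * M%:R) + gamma * z.
  have M1 : 0 < 1 + 2 * M%:R :> R by rewrite ltr_pwDl // mulr_ge0.
  have q0 : 0 < q by exact: lt_le_trans q1.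
  have sgt0 : 0 < s%:R :> R by rewrite ltr0n.
  apply: (@le_trans _ _ (ln (s%:R * ((1 + 2 * M%:R) * q)))).
    by rewrite ler_ln ?posrE ?(lt_le_trans ltr01 N1) ?mulr_gt0.
  rewrite !lnM ?posrE ?mulr_gt0 // -addrA lerD2l lerD2l ln_powR ler_wpM2l //.
  by rewrite le_ln1Dx // (lt_le_trans _ z0) // ltrN10.
apply: ler_pM => //; first by rewrite ln_ge0.
by rewrite truncn_le.
Qed.

(** * From complexity bounds to tractability *)

Section Tractability.
Context {R : realType} {F : scalarKind} {H : hilbertSpace R F}.
Variables (e : nat -> H) (omega : R) (m : nat -> nat) (a b : nat -> R).
Variable T : forall s, tensorPower H s.
Hypotheses (e_basis : orthonormal_basis e) (omega_itv : 0 < omega < 1).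
Hypothesis m_gt0 : forall k, (0 < m k)%N.
Hypothesis a_gt0 : 0 < a 0%N.
Hypothesis a_mono : forall i j, (i <= j)%N -> a i <= a j.
Hypothesis b_gt0 : forall j, 0 < b j.

Local Notation info s eps := (info_complexity e omega m a b (T s) eps).

Lemma lne_info_complexity_le : m 0 = 1%N -> (exists M, forall k, (m k <= M)%N) ->
  0 < inf (range b) -> exists2 D : R, 0 < D & forall s eps, (0 < s)%N -> 0 < eps < 1 ->
    (lne (info s eps) <= (D * (1 + ln s%:R ^+ 2 + ln eps^-1 ^+ 2))%:E)%E.
Proof.
move=> m0 [M m_le] beta_gt0; set beta := inf (range b) in beta_gt0.
have b_ge j : beta <= b j.
  by apply: ge_inf; [exists 0 => _ [i _ <-]; exact: ltW | exists j].
have gamma0 : 0 <= beta^-1 by rewrite invr_ge0 ltW.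
have /andP[w0 w1] := omega_itv.
(* With this [K], the bound [z] equals K ln(1/eps). *)
pose K := 2 / (- ln omega * a 0%N).
pose A := ln (1 + 2 * M%:R) : R.
exists (1 + A ^+ 2 + (2 + beta^-1) * K ^+ 2) => [|s eps s0 eps01].
  by rewrite -addrA ltr_pwDl // addr_ge0 ?sqr_ge0 // mulr_ge0 ?sqr_ge0 // addr_ge0.
have /andP[eps0 eps1] := eps01.
set p := ln s%:R; set L := ln eps^-1.
have c0 : 0 < - ln omega by rewrite oppr_gt0 ln_lt0 // w0.
have L0 : 0 <= L by rewrite ln_ge0 // invf_ge1 // ltW.
have z0 : 0 <= 2 * L / (- ln omega * a 0%N).
  by rewrite divr_ge0 ?mulr_ge0 ?(ltW a_gt0) ?(ltW c0).
have := info_complexity_le e omega m a b e_basis omega_itv m_gt0 a_gt0 a_mono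
  m0 M m_le beta beta_gt0 b_ge s (T s) eps eps01.
have := info_complexity_ge1 e omega m a b e_basis m_gt0 b_gt0 s (T s) eps eps1.
rewrite -/L /=; set z := 2 * _ / _ in z0 *; set N := (_ ^ _)%N => info1 infoN.
have N0 : 0 < N%:R :> R by rewrite ltr0n expn_gt0.
apply: (@le_trans _ _ (lne N%:R%:E)).
  by rewrite lee_lne // in_itv /= leey andbT ?lee_fin ?ler0n // (le_trans _ info1).
rewrite lne_EFin // lee_fin; apply: le_trans (ln_count_le _ _ _ _ _ z0 gamma0 s0) _.
rewrite -/p -/A.
have -> : z = K * L by rewrite /z /K mulrAC.
set y := K * L.
(* The mixed products are absorbed by completing two squares, which costs y^2/4 each. *)
have h1 : y * (p + A + beta^-1 * y) <= p ^+ 2 + A ^+ 2 + (2 + beta^-1) * y ^+ 2.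
  rewrite -subr_ge0; have -> : p ^+ 2 + A ^+ 2 + (2 + beta^-1) * y ^+ 2 -
    y * (p + A + beta^-1 * y) =
    (p - y / 2) ^+ 2 + (A - y / 2) ^+ 2 + (3 / 2) * y ^+ 2.
    by field; rewrite gt_eqF.
  by rewrite !addr_ge0 ?sqr_ge0 // mulr_ge0 ?sqr_ge0.
apply: le_trans h1 _; rewrite /y exprMn.
set k2 := K ^+ 2; set p2 := p ^+ 2; set A2 := A ^+ 2; set L2 := L ^+ 2.
have [k20 p20 A20 L20] : [/\ 0 <= k2, 0 <= p2, 0 <= A2 & 0 <= L2] by rewrite !sqr_ge0.
set g := 2 + beta^-1; have g1 : 0 <= g by rewrite addr_ge0.
rewrite -subr_ge0; have -> : (1 + A2 + g * k2) * (1 + p2 + L2) - (p2 + A2 + g * (k2 * L2)) =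
  1 + L2 + A2 * (p2 + L2) + g * k2 * (1 + p2) by ring.
have h2 : 0 <= A2 * (p2 + L2) by apply: mulr_ge0 => //; exact: addr_ge0.
have h3 : 0 <= g * k2 * (1 + p2) by apply: mulr_ge0; [exact: mulr_ge0 | exact: addr_ge0].
by apply: addr_ge0 => //; apply: addr_ge0 => //; exact: addr_ge0.
Qed.

(** With U = s^(t1/2) and V = eps^(-t2/2), the squared logarithms are O(U + V), while the
    denominator U^2 + V^2 is at least (U + V)^2 / 2. The quotient is thus O(1 / (U + V)). *)
Lemma uniform_weak_tractability : m 0 = 1%N -> (exists M, forall k, (m k <= M)%N) ->
  0 < inf (range b) -> UWT e omega m a b T.
Proof.
move=> m0 m_bounded b_inf t1 t2 /andP[t10 _] /andP[t20 _].
have [D D0 infoD] := lne_info_complexity_le m0 m_bounded b_inf.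
pose C := 1 + (4 / t1) ^+ 2 + (4 / t2) ^+ 2.
have C0 : 0 < C by rewrite /C -addrA ltr_pwDl // addr_ge0 ?sqr_ge0.
pose t := Num.min (t1 / 2) (t2 / 2).
have tgt0 : 0 < t by rewrite lt_min !divr_gt0.
move=> P nP.
have /nbhs_ballP[d /= d0 dP] : nbhs (0 : R) (fun r => P r%:E) by exact: nP.
(* Once U + V exceeds [Q], the bound 2DC / (U + V) drops below [d]. *)
pose Q := 2 * D * C / d.
have Q0 : 0 < Q by rewrite divr_gt0 ?mulr_gt0.
exists (2 * Q `^ t^-1) => // -[s eps] /= [s0 eps01 large].
have /andP[eps0 eps1] := eps01.
have s1 : (1 : R) <= s%:R by rewrite ler1n.
have x1 : 1 <= eps^-1 by rewrite invf_ge1 // ltW.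
set x := eps^-1 in x1 large.
pose U := s%:R `^ (t1 / 2) : R; pose V := x `^ (t2 / 2).
have U1 : 1 <= U by rewrite -(powRr0 s%:R) ler_powR // divr_ge0 // ltW.
have V1 : 1 <= V by rewrite -(powRr0 x) ler_powR // divr_ge0 // ltW.
have UV : Q < U + V.
  have grow y : 1 <= y -> Q `^ t^-1 < y -> Q < y `^ t.
    move=> y1 Qy; rewrite -[Q]powRr1 ?(ltW Q0) // -(mulVf (lt0r_neq0 tgt0)) powRrM.
    by rewrite gt0_ltr_powR // nnegrE ?powR_ge0 // (le_trans ler01).
  (* A sum above twice Q^(1/t) has a summand above Q^(1/t); as [t] is the smaller of the two half
     exponents, U or V alone then exceeds [Q]. *)
  have [Qs|sQ] := ltP (Q `^ t^-1) s%:R.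
    apply: lt_trans (_ : U < _); last by rewrite ltrDl (lt_le_trans ltr01).
    by apply: lt_le_trans (grow _ s1 Qs) _; rewrite ler_powR // ge_min lexx.
  have Qx : Q `^ t^-1 < x.
    by rewrite -(ltrD2l s%:R) (le_lt_trans _ large) // mulr2n mulrDl mul1r lerD2r.
  apply: lt_trans (_ : V < _); last by rewrite ltrDr (lt_le_trans ltr01).
  by apply: lt_le_trans (grow _ x1 Qx) _; rewrite ler_powR // ge_min lexx orbT.
have UE : s%:R `^ t1 = U ^+ 2 by rewrite -powR_mulrn ?powR_ge0 // -powRrM; congr (_ `^ _); field.
have VE : eps `^ (- t2) = V ^+ 2.
  rewrite -powR_mulrn ?powR_ge0 // -powRrM /x -[eps^-1]powR_inv1 ?(ltW eps0) // -powRrM.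
  by congr (_ `^ _); field.
rewrite UE VE.
have := infoD s eps s0 eps01.
have := info_complexity_ge1 e omega m a b e_basis m_gt0 b_gt0 s (T s) eps eps1.
(* Lying between 0 and a finite bound, the logarithm is a real [r]. *)
rewrite -lne_ge0; case: (lne _) => [r| |] //; rewrite !lee_fin => r0 rD.
have W0 : 0 < U ^+ 2 + V ^+ 2 by rewrite addr_gt0 ?exprn_gt0 ?(lt_le_trans ltr01).
rewrite inver gt_eqF // -EFinM; apply: (dP (r / _)).
rewrite -ball_normE /= sub0r normrN ger0_norm ?divr_ge0 ?(ltW W0) //.
rewrite ltr_pdivrMr //.
have rDC : r <= D * C * (U + V).
  apply: le_trans rD _; rewrite -mulrA ler_pM2l //.
  have := sqr_ln_le _ _ _ t10 s1; have := sqr_ln_le _ _ _ t20 x1; rewrite -/U -/V => hV hU.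
  have -> : C * (U + V) = U + V + (4 / t1) ^+ 2 * U + (4 / t2) ^+ 2 * V
     + ((4 / t1) ^+ 2 * V + (4 / t2) ^+ 2 * U) by rewrite /C; ring.
  rewrite -[leLHS]addr0; apply: lerD.
    apply: lerD => //; apply: lerD => //.
    by rewrite (le_trans U1) // lerDl (le_trans ler01).
  by rewrite addr_ge0 // mulr_ge0 ?sqr_ge0 // (le_trans ler01).
apply: le_lt_trans rDC _.
have DCd : 2 * D * C < d * (U + V) by rewrite [ltRHS]mulrC -ltr_pdivrMr.
have UV0 : 0 < U + V by rewrite addr_gt0 // (lt_le_trans ltr01).
have sq : (U + V) ^+ 2 <= 2 * (U ^+ 2 + V ^+ 2).
  rewrite -subr_ge0; have -> : 2 * (U ^+ 2 + V ^+ 2) - (U + V) ^+ 2 = (U - V) ^+ 2 by ring.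
  exact: sqr_ge0.
rewrite -(@ltr_pM2l _ 2) // !mulrA.
apply: lt_le_trans (_ : d * (U + V) * (U + V) <= _); first by rewrite ltr_pM2r.
by rewrite -!mulrA [X in _ <= X]mulrCA ler_pM2l.
Qed.

(** If m_0 >= 2, fix eps = 1/2: the complexity is at least 2^s, so the quotient is at least s ln 2 /
    (s + 2) and does not tend to 0. *)
Lemma weak_tractability_m0 : WT e omega m a b T -> m 0 = 1%N.
Proof.
move=> wt; apply/eqP; rewrite eqn_leq m_gt0 andbT leqNgt; apply/negP => m2.
have ln2 : 0 < ln (2 : R) by rewrite ln_gt0 // ltr1n.
(* s / (s + 2) >= 1/3 for every s >= 1. *)
pose c : R := ln 2 / 3.
have c0 : 0 < c by rewrite divr_gt0.
have nc : nbhs (0%E : \bar R) [set x | (x < c%:E)%E].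
  have : nbhs (0 : R) (fun r => (r%:E < c%:E)%E); last by exact.
  apply/nbhs_ballP; exists c => //= r; rewrite -ball_normE /= sub0r normrN lte_fin.
  exact: le_lt_trans (ler_norm _).
have [B _ hB] := wt _ nc.
pose s := (Num.truncn `|B|).+1.
have Bs : B < s%:R by apply: le_lt_trans (ler_norm B) (truncnS_gt _).
have half : 0 < (2^-1 : R) < 1 by apply/andP; split; lra.
have large : [/\ (0 < s)%N, 0 < (2^-1 : R) < 1 & B < s%:R + 2^-1^-1].
  by split => //; rewrite (lt_trans Bs) // ltrDl invrK.
have := hB (s, 2^-1) large; apply/negP; rewrite /= -leNgt.
have s0 : (0 : R) < s%:R by rewrite ltr0n.
rewrite powRr1 ?(ltW s0) // powR_inv1 ?invr_ge0 // invrK.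
have sW : 0 < s%:R + 2 :> R by rewrite addr_gt0.
have infos : ((s%:R * ln 2)%:E <= lne (info s 2^-1))%E.
  have -> : s%:R * ln 2 = ln (2 ^ s)%N%:R :> R by rewrite natrX lnXn // mulr_natl.
  have p0 : (0 : R) < (2 ^ s)%N%:R by rewrite ltr0n expn_gt0.
  have le_info : ((2 ^ s)%N%:R%:E <= info s 2^-1)%E.
    have /andP[_ half1] := half.
    apply: le_trans (info_complexity_ge e omega m a b e_basis m_gt0 b_gt0 s (T s) _ half1).
    by rewrite lee_fin ler_nat leq_exp2r.
  rewrite -lne_EFin // lee_lne // in_itv /= leey andbT ?lee_fin ?ler0n //.
  by apply: le_trans le_info; rewrite lee_fin ler0n.
rewrite inver gt_eqF //.
apply: le_trans (lee_wpmul2r _ infos); last by rewrite lee_fin invr_ge0 ltW.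
rewrite -EFinM lee_fin ler_pdivlMr // /c.
have s1 : (1 : R) <= s%:R by rewrite ler1n.
rewrite -subr_ge0.
have -> : s%:R * ln 2 - ln 2 / 3 * (s%:R + 2) = 2 / 3 * (ln 2 * (s%:R - 1)) :> R by field.
by rewrite mulr_ge0 ?mulr_ge0 ?(ltW ln2) ?subr_ge0.
Qed.

End Tractability.

Theorem theorem3 (R : realType) (F : scalarKind) (H : hilbertSpace R F)
    (e : nat -> H) (omega : R) (m : nat -> nat) (a b : nat -> R)
    (T : forall s : nat, tensorPower H s)
    (he : orthonormal_basis e)
    (homega : 0 < omega < 1)
    (hm_pos : forall k : nat, (0 < m k)%N)
    (hm_bounded : exists M : nat, forall k : nat, (m k <= M)%N)
    (ha_pos : 0 < a 0%N)
    (ha_mono : forall i j : nat, (i <= j)%N -> a i <= a j)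
    (hb_pos : forall j : nat, 0 < b j)
    (hb_inf : 0 < inf (range b)) :
  (WT e omega m a b T <-> UWT e omega m a b T) /\
  (UWT e omega m a b T <-> m 0%N = 1%N).
Proof.
have wt_m0 := weak_tractability_m0 e omega m a b T he hm_pos hb_pos.
have m0_uwt : m 0 = 1%N -> UWT e omega m a b T.
  by move=> m0; exact: uniform_weak_tractability.
have uwt_wt : UWT e omega m a b T -> WT e omega m a b T.
  by move=> uwt; apply: uwt; rewrite ltr01 lexx.
by split; split; auto.
Qed.
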